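(* There is an absolute constant $K>0$ such that the following holds. Let $n\in\mathbb{N}$, let $f:\{0,1\}^n\to\{0,1\}$ be an arbitrary function, let $\gamma$ satisfy $\tfrac{27}{2^{n/2}}<\gamma<\tfrac12$, and let $H$ be any probability distribution over $\{0,1\}^n$. Then there exists a circuit $C$ of size at most $K\left(\frac{\gamma^2 2^n}{\log(\gamma^2 2^n)}+n\right)$ such that $\Pr_{x\sim H}[C(x)=f(x)]\ge \tfrac12+\gamma$.
   Context: Circuits have gates computing arbitrary Boolean functions of fan-in 2, arbitrary depth, and size is the number of gates. Logarithms are base 2. *)

(* Defs.v *)
From HB Require Import structures.
From mathcomp Require Import all_boot all_order all_algebra.
From mathcomp Require Import reals exp.

Set Implicit Arguments.
Unset Strict Implicit.
Unset Printing Implicit Defensive.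
Import Order.TTheory GRing.Theory Num.Theory.

Local Open Scope ring_scope.

(* Boolean circuits over the full binary basis, as straight-line programs:
   wires 0, ..., n-1 are the inputs and wire n+k is the value of the k-th gate.
   A gate may ignore one or both of its arguments, and may read the same wire
   twice, so constants and unary functions are included. *)
Record gate := Gate {
  gate_op : bool -> bool -> bool;
  gate_l : nat;
  gate_r : nat }.

(* Each gate only reads wires that precede it; m is the number of wires
   available to the first gate of the list. *)
Fixpoint wf_gates (m : nat) (gs : seq gate) : bool :=
  if gs is g :: gs' then
    [&& (gate_l g < m)%N, (gate_r g < m)%N & wf_gates m.+1 gs']
  else true.

(* The default value of nth is never used when wf_gates (size w) gs holds. *)
Fixpoint run_gates (gs : seq gate) (w : seq bool) : seq bool :=
  if gs is g :: gs' then
    run_gates gs'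
      (rcons w (gate_op g (nth false w (gate_l g)) (nth false w (gate_r g))))
  else w.

(* The output may be any wire, including an input. *)
Record circuit (n : nat) := Circuit {
  gates : seq gate;
  output : nat;
  gates_wf : wf_gates n gates;
  output_wf : (output < n + size gates)%N }.

Definition circuit_size (n : nat) (C : circuit n) : nat := size (gates C).

Definition circuit_eval (n : nat) (C : circuit n) (x : n.-tuple bool) : bool :=
  nth false (run_gates (gates C) x) (output C).

Definition log2 (R : realType) (x : R) : R := ln x / ln 2.

Definition is_distribution (R : realType) (T : finType) (H : {ffun T -> R}) :=
  (forall x, 0 <= H x) /\ \sum_x H x = 1.

Definition Pr (R : realType) (T : finType) (H : {ffun T -> R}) (A : pred T) : R :=
  \sum_(x | A x) H x.

(* Main.v *)
(* Put N = gamma^2 2^n and take the least m with 2^m >= 25 N.  If m > n, a lookup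
   table for f is cheap enough.  Otherwise split the cube into 2^m buckets by the
   first m bits and predict f(x) by s(x) + tau(bucket of x), where
   s(x) = <r,x> + sum_(i < k) <p_i,x><q_i,x> with k >= m, and tau is the best
   choice of signs.  With a = H (-1)^f, the advantage is (up to a factor 2) the sum
   over buckets b of |X_b|, where X_b is the sum of a (-1)^s over b.

   Suppose all advantages are below Lam = 2 gamma.  Taking p = q = 0, each Fourier
   coefficient of each a_b is below Lam.  For random r, p, q, with
   sigma_b^2 = sum a_b^2,
     E X_b^2 = sigma_b^2  and
     E X_b^4 <= 3 sigma_b^4 + 4^-k E_r (hat a_b(r))^4
             <= 3 sigma_b^4 + 4^-k Lam^2 sigma_b^2,
   because the product of the signs at four distinct points of sum 0 has mean
   4^-k.  Hence
   E |X_b| >= sigma_b / 2 - 2^-k Lam / 4, and summing over b with Cauchy-Schwarz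
   makes the expected advantage at least 2^((m-n)/2) / 2 - Lam / 4 >= Lam, a
   contradiction.

   The predictor is small: the table for tau costs O(2^m / m) gates, and O(m)
   linear forms cost only O(n + 2^m / m), by splitting them into four groups and
   adding up, in each group, the inputs with equal coefficient vectors first. *)

Require Import Defs.
From mathcomp Require Import all_boot all_order all_algebra.
From mathcomp Require Import reals exp.
From mathcomp Require Import ring lra zify.
Import Order.TTheory GRing.Theory Num.Theory.

Set Implicit Arguments.
Unset Strict Implicit.
Unset Printing Implicit Defensive.

Local Notation boolfun n := {ffun n.-tuple bool -> bool}.
Local Notation bitvec n := {ffun 'I_n -> bool}.
Local Notation pairs n k := {ffun 'I_k -> bitvec n * bitvec n}.

(** * Circuits as chains of Boolean functions *)

Lemma wf_gates_rcons m gs g :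
  wf_gates m (rcons gs g)
  = [&& wf_gates m gs, gate_l g < m + size gs & gate_r g < m + size gs].
Proof.
elim: gs m => [|h gs IH] m /=; first by rewrite addn0 andbT.
by rewrite IH addSnnS -!andbA.
Qed.

Lemma run_gates_rcons gs g w :
  run_gates (rcons gs g) w
  = rcons (run_gates gs w)
      (gate_op g (nth false (run_gates gs w) (gate_l g))
                 (nth false (run_gates gs w) (gate_r g))).
Proof. by elim: gs w => [|h gs IH] w //=. Qed.

Definition input n (i : 'I_n) : boolfun n := [ffun x => tnth x i].

Definition inputs n := [seq input i | i <- enum 'I_n].

(** Wires are identified with the functions they carry, so no wire number has to be shifted when
    straight-line programs are joined. *)
Inductive chain n : seq (boolfun n) -> Prop :=
| chain_nil : chain [::]
| chain_rcons l (op : bool -> bool -> bool) f g :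
    chain l -> f \in inputs n ++ l -> g \in inputs n ++ l ->
    chain (rcons l [ffun x => op (f x) (g x)]).

Lemma chain_gates n (l : seq (boolfun n)) :
  chain l -> exists gs, [/\ wf_gates n gs, size gs = size l
    & forall x : n.-tuple bool, run_gates gs x = [seq f x | f : boolfun n <- inputs n ++ l]].
Proof.
elim=> [|{}l op f g _ [gs [wf sz run]] fl gl].
  exists [::]; split=> // x /=; rewrite cats0 /inputs -map_comp.
  rewrite -[LHS](map_tnth_enum x); apply: eq_map => i; by rewrite /= ffunE.
have szl : size (inputs n ++ l) = n + size gs.
  by rewrite size_cat size_map size_enum_ord sz.
(* If a function sits on several wires, [index] picks the first of them, which carries the same
   values. *)
pose gt := Gate op (index f (inputs n ++ l)) (index g (inputs n ++ l)).
exists (rcons gs gt); split.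
- by rewrite wf_gates_rcons wf /= -szl !index_mem fl gl.
- by rewrite !size_rcons sz.
move=> x; rewrite run_gates_rcons run /= -rcons_cat map_rcons ffunE.
by congr (rcons _ (op _ _)); rewrite (nth_map [ffun => false]) ?index_mem ?nth_index.
Qed.

Lemma chain_circuit n (l : seq (boolfun n)) f :
  chain l -> f \in inputs n ++ l ->
  exists C : circuit n, circuit_size C = size l /\ circuit_eval C =1 f.
Proof.
move=> /chain_gates[gs [wf sz run]] fl.
have szl : size (inputs n ++ l) = n + size gs.
  by rewrite size_cat size_map size_enum_ord sz.
have out : index f (inputs n ++ l) < n + size gs by rewrite -szl index_mem.
exists (Circuit wf out); split=> // x; rewrite /circuit_eval /= run.
by rewrite (nth_map [ffun => false]) ?index_mem ?nth_index.
Qed.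

(** Quantifying over every chain that already has [A] makes costs add under composition and lets
    wires built once be reused for free. *)
Definition computes n (A : seq (boolfun n)) (s : nat)
    (G : seq (boolfun n)) :=
  forall l, chain l -> {subset A <= inputs n ++ l} ->
  exists l', [/\ chain (l ++ l'), size l' <= s & {subset G <= inputs n ++ l ++ l'}].

Lemma computes_circuit n s (f : boolfun n) :
  computes [::] s [:: f] ->
  exists C : circuit n, circuit_size C <= s /\ circuit_eval C =1 f.
Proof.
move=> /(_ [::] (chain_nil n)) [//|l [/= chl szl fl]].
have [|C [szC evC]] := chain_circuit chl (f := f); first by rewrite fl ?inE.
by exists C; rewrite szC.
Qed.

Lemma computes_sub n (A G A' G' : seq (boolfun n)) s s' :
  {subset A <= inputs n ++ A'} -> s <= s' -> {subset G' <= inputs n ++ A' ++ G} ->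
  computes A s G -> computes A' s' G'.
Proof.
move=> AA ss GG cAG l chl Al.
have [|l' [chl' sl' Gl']] := cAG l chl.
  by move=> f /AA; rewrite !mem_cat => /orP[-> //|/Al]; rewrite mem_cat.
exists l'; split=> //; first exact: leq_trans ss.
move=> f /GG; rewrite !mem_cat => /or3P[->//|/Al|/Gl'].
  by rewrite mem_cat => /orP[]->; rewrite ?orbT.
by rewrite !mem_cat.
Qed.

Lemma computes_cat n (A G G' : seq (boolfun n)) s s' :
  computes A s G -> computes (A ++ G) s' G' -> computes A (s + s') (G ++ G').
Proof.
move=> c1 c2 l chl Al; have [l1 [ch1 s1 G1]] := c1 l chl Al.
have [|l2 [ch2 s2 G2]] := c2 _ ch1.
  move=> f; rewrite mem_cat => /orP[/Al|/G1//].
  by rewrite !mem_cat => /orP[]->; rewrite ?orbT.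
exists (l1 ++ l2); split; rewrite ?catA // -?catA //.
  by rewrite size_cat leq_add.
move=> f; rewrite mem_cat => /orP[/G1|/G2]; rewrite -?catA !mem_cat;
  by repeat case: (f \in _).
Qed.

Lemma computes0 n (A G : seq (boolfun n)) :
  {subset G <= inputs n ++ A} -> computes A 0 G.
Proof.
move=> GA l chl Al; exists [::]; rewrite cats0; split=> // f /GA.
by rewrite mem_cat => /orP[|/Al //]; rewrite mem_cat => ->.
Qed.

Lemma computes_gate n (A : seq (boolfun n)) (op : bool -> bool -> bool) f g :
  f \in inputs n ++ A -> g \in inputs n ++ A ->
  computes A 1 [:: [ffun x => op (f x) (g x)]].
Proof.
move=> fA gA l chl Al; exists [:: [ffun x => op (f x) (g x)]].
have sub h : h \in inputs n ++ A -> h \in inputs n ++ l.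
  by rewrite mem_cat => /orP[|/Al//]; rewrite mem_cat => ->.
split=> //; first by rewrite cats1; apply: chain_rcons => //; exact: sub.
by move=> h hG; rewrite catA mem_cat hG orbT.
Qed.

Lemma computes_gate_of n (A : seq (boolfun n)) (op : bool -> bool -> bool) f g s s' :
  computes A s [:: f] -> computes A s' [:: g] ->
  computes A (s + s').+1 [:: [ffun x => op (f x) (g x)]].
Proof.
move=> cf cg.
have cfg : computes A (s + s') ([:: f] ++ [:: g]).
  apply: computes_cat cf _; apply: computes_sub cg => // h hA; rewrite !mem_cat hA ?orbT //.
apply: computes_sub (computes_cat cfg (computes_gate op (f := f) (g := g) _ _)) => //.
- by move=> h hA; rewrite mem_cat hA orbT.
- by rewrite addn1.
- by move=> h; rewrite !mem_cat !inE => ->; rewrite !orbT.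
- by rewrite !mem_cat !inE eqxx !orbT.
- by rewrite !mem_cat !inE eqxx !orbT.
Qed.

Lemma computes_map n (I : eqType) (r : seq I) (A : seq (boolfun n))
    (F : I -> boolfun n) (c : I -> nat) :
  {in r, forall i, computes A (c i) [:: F i]} ->
  computes A (\sum_(i <- r) c i) [seq F i | i <- r].
Proof.
elim: r => [|i r IH] cF; first by rewrite big_nil; exact: computes0.
rewrite big_cons map_cons -cat1s; apply: computes_cat; first by apply: cF; rewrite inE eqxx.
apply: computes_sub (IH _) => // [h hA|h hG|h hG]; last by apply: cF; rewrite inE hG orbT.
  by rewrite !mem_cat hA !orbT.
by rewrite !mem_cat hG !orbT.
Qed.

Lemma computes_all n (A G : seq (boolfun n)) c :
  {in G, forall g, computes A c [:: g]} -> computes A (c * size G) G.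
Proof.
move=> cG; have := @computes_map n _ G A id (fun=> c) cG.
by rewrite map_id big_const_seq count_predT iter_addn_0.
Qed.

(** The gate ignores its arguments but still has to read a wire, so an input must exist. *)
Lemma computes_const n (A : seq (boolfun n)) (b : bool) :
  0 < n -> computes A 1 [:: [ffun => b]].
Proof.
move=> n0; pose i := Ordinal n0.
have iA : input i \in inputs n ++ A by rewrite mem_cat map_f ?mem_enum.
apply: computes_sub (computes_gate (fun _ _ => b) iA iA) => // [h hA|h].
  by rewrite mem_cat hA orbT.
rewrite !inE => /eqP ->; rewrite !mem_cat !inE; apply/orP; right; apply/orP; right.
by apply/eqP/ffunP => x; rewrite !ffunE.
Qed.

(** Addition in [bool] is exclusive or; the extra gate is the constant false that starts the sum. *)
Lemma computes_xor n (A F : seq (boolfun n)) :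
  0 < n -> {subset F <= inputs n ++ A} ->
  computes A (size F).+1 [:: [ffun x => (\sum_(f <- F) f x)%R]].
Proof.
move=> n0; elim: F => [|f F IH] FA.
  rewrite (_ : finfun _ = [ffun => false]); first exact: computes_const.
  by apply/ffunP => x; rewrite !ffunE big_nil.
rewrite (_ : finfun _ = [ffun x => addb (f x) ([ffun y => (\sum_(g <- F) g y)%R] x)]); last first.
  by apply/ffunP => x; rewrite !ffunE big_cons.
rewrite -[(size _).+1]/((0 + (size F).+1).+1).
apply: computes_gate_of.
  by apply: computes0 => g; rewrite inE => /eqP ->; apply: FA; rewrite inE eqxx.
by apply: IH => g gF; apply: FA; rewrite inE gF orbT.
Qed.

(** * Multiplexers and lookup tables *)

Definition mux n (v g0 g1 : boolfun n) : boolfun n :=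
  [ffun x => if v x then g1 x else g0 x].

Lemma computes_mux n (A : seq (boolfun n)) v g0 g1 s0 s1 :
  v \in inputs n ++ A -> computes A s0 [:: g0] -> computes A s1 [:: g1] ->
  computes A (s0 + s1 + 3) [:: mux v g0 g1].
Proof.
move=> vA c0 c1.
have cv : computes A 0 [:: v] by apply: computes0 => h; rewrite inE => /eqP ->.
have := computes_gate_of orb (computes_gate_of andb cv c1)
          (computes_gate_of (fun a b => ~~ a && b) cv c0).
apply: computes_sub => // [h hA||h]; first by rewrite mem_cat hA orbT.
  by rewrite !add0n; lia.
rewrite !inE => /eqP ->; rewrite !mem_cat !inE; apply/orP; right; apply/orP; right.
by apply/eqP/ffunP => x; rewrite !ffunE; case: (v x); rewrite ?orbF.
Qed.

Definition lookup n (tau : seq bool -> bool) (vs : seq (boolfun n)) :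
  boolfun n := [ffun x => tau [seq v x | v : boolfun n <- vs]].

(** Expansion on the first wire lists every Boolean function of the wires [vs], each one a
    multiplexer of two functions of the remaining wires. *)
Fixpoint all_lookups n (vs : seq (boolfun n)) : seq (boolfun n) :=
  if vs is v :: vs' then
    [seq mux v g0 g1 | g0 <- all_lookups vs', g1 <- all_lookups vs']
  else [:: [ffun => false]; [ffun => true]].

Lemma lookup_cons n tau v (vs : seq (boolfun n)) :
  lookup tau (v :: vs)
  = mux v (lookup (fun s => tau (false :: s)) vs) (lookup (fun s => tau (true :: s)) vs).
Proof. by apply/ffunP => x; rewrite !ffunE /=; case: (v x). Qed.

Lemma mem_all_lookups n tau (vs : seq (boolfun n)) :
  lookup tau vs \in all_lookups vs.
Proof.
elim: vs tau => [|v vs IH] tau /=.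
  rewrite !inE; case tau0: (tau [::]); apply/orP; [right|left];
  by apply/eqP/ffunP => x; rewrite !ffunE.
by rewrite lookup_cons; apply/allpairsP; exists (lookup (fun s => tau (false :: s)) vs,
  lookup (fun s => tau (true :: s)) vs); split => //=; exact: IH.
Qed.

Lemma size_all_lookups n (vs : seq (boolfun n)) :
  size (all_lookups vs) = 2 ^ 2 ^ size vs.
Proof. by elim: vs => //= v vs IH; rewrite size_allpairs IH -expnD addnn expnS mul2n. Qed.

Lemma computes_all_lookups n (A vs : seq (boolfun n)) :
  0 < n -> {subset vs <= inputs n ++ A} ->
  computes A (6 * 2 ^ 2 ^ size vs) (all_lookups vs).
Proof.
move=> n0; elim: vs => [|v vs IH] vsA.
  apply: computes_sub (computes_all (A := A) (G := all_lookups [::]) (c := 1) _) => // [h hA|h hG|h hG].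
  - by rewrite mem_cat hA orbT.
  - by rewrite !mem_cat hG !orbT.
  - by move: hG; rewrite !inE => /orP[]/eqP ->; exact: computes_const.
have {}IH := IH (fun h hvs => vsA h (mem_behead (s := v :: vs) hvs)).
have all_mux : computes (A ++ all_lookups vs) (3 * size (all_lookups (v :: vs)))
    (all_lookups (v :: vs)).
  apply: computes_all => g /allpairsP[[g0 g1] [/= g0vs g1vs ->]].
  have -> : 3 = 0 + 0 + 3 by [].
  apply: computes_mux.
  - by move: (vsA v); rewrite inE eqxx !mem_cat => /(_ isT)/orP[]->; rewrite ?orbT.
  - by apply: computes0 => h; rewrite inE => /eqP ->; rewrite !mem_cat g0vs !orbT.
  - by apply: computes0 => h; rewrite inE => /eqP ->; rewrite !mem_cat g1vs !orbT.
apply: computes_sub (computes_cat IH all_mux) => // [h hA||h hG].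
- by rewrite mem_cat hA orbT.
- rewrite size_all_lookups /=; set t := size vs.
  have -> : 2 ^ 2 ^ t.+1 = 2 ^ 2 ^ t * 2 ^ 2 ^ t by rewrite -expnD addnn expnS mul2n.
  (* With [X = 2 ^ 2 ^ t], the claim is [6 * X + 3 * X ^ 2 <= 6 * X ^ 2], which holds once
     [X >= 2]. *)
  have : 2 <= 2 ^ 2 ^ t by rewrite -{1}[2]/(2 ^ 1) leq_exp2l // expn_gt0.
  by nia.
- by rewrite !mem_cat hG !orbT.
Qed.

(** A full binary tree of multiplexers on [us], whose leaves are functions of [vs] that are already
    available. *)
Lemma computes_lookup_tree n (A us vs : seq (boolfun n)) tau :
  {subset us <= inputs n ++ A} -> {subset all_lookups vs <= A} ->
  computes A (3 * (2 ^ size us).-1) [:: lookup tau (us ++ vs)].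
Proof.
move=> usA vsA; elim: us usA tau => [|u us IH] usA tau /=.
  apply: computes0 => h; rewrite inE => /eqP ->.
  by rewrite mem_cat vsA ?orbT ?mem_all_lookups.
have {}IH := IH (fun h hus => usA h (mem_behead (s := u :: us) hus)).
rewrite lookup_cons.
have := computes_mux (usA u (mem_head _ _)) (IH (fun s => tau (false :: s)))
  (IH (fun s => tau (true :: s))).
apply: computes_sub => // [h hA||h hG]; rewrite ?mem_cat ?hA ?hG ?orbT //.
have := expn_gt0 2 (size us); rewrite expnS; lia.
Qed.

(** Shannon's construction: all functions of the last [j] wires are built once, and a tree on the
    other [m - j] wires selects among them. Taking [j] close to [log2 (m / 2)] makes the first cost
    at most about [2 ^ (m / 2)] and the second of order [2 ^ m / m]. *)
Lemma computes_lookup n (A vs : seq (boolfun n)) tau :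
  0 < n -> {subset vs <= inputs n ++ A} ->
  exists2 s, computes A s [:: lookup tau vs] & s * size vs <= 24 * 2 ^ size vs.
Proof.
move=> n0 vsA; set m := size vs; pose j := trunc_log 2 m./2.
have jm : j <= m.
  have : j < 2 ^ j by exact: ltn_expl.
  case: (posnP m./2) => [m0|m0]; first by rewrite /j m0.
  by have := trunc_logP (isT : 1 < 2) m0; rewrite -/j; lia.
have size_take : size (take (m - j) vs) = m - j by rewrite size_takel // leq_subr.
have size_drop : size (drop (m - j) vs) = j by rewrite size_drop -/m subKn.
exists (6 * 2 ^ 2 ^ j + 3 * (2 ^ (m - j)).-1).
  have dropA : {subset drop (m - j) vs <= inputs n ++ A} by move=> h /mem_drop /vsA.
  have c1 := computes_all_lookups n0 dropA.
  have c2 : computes (A ++ all_lookups (drop (m - j) vs)) (3 * (2 ^ size (take (m - j) vs)).-1)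
      [:: lookup tau (take (m - j) vs ++ drop (m - j) vs)].
    apply: computes_lookup_tree => h; last by move=> hG; rewrite mem_cat hG orbT.
    by move=> /mem_take /vsA; rewrite !mem_cat => /orP[]->; rewrite ?orbT.
  have := computes_cat c1 c2; rewrite cat_take_drop size_take size_drop.
  apply: computes_sub => // h hA; first by rewrite mem_cat hA orbT.
  by rewrite !mem_cat hA !orbT.
have m4 : m <= 4 * 2 ^ j.
  have := trunc_log_ltn m./2 (isT : 1 < 2); rewrite -/j expnS; lia.
have split_m : 2 ^ (m - j) * 2 ^ j = 2 ^ m by rewrite -expnD subnK.
have [m1|m2] := leqP m 1.
  have -> : j = 0 by rewrite /j; case: (m) m1 => [|[|]].
  by case: (m) m1 => [|[|]].
have pow_j : 2 ^ j <= m./2 by apply: trunc_logP => //; lia.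
have : 2 ^ 2 ^ j <= 2 ^ m./2 by rewrite leq_exp2l.
have : m <= 2 * 2 ^ uphalf m by have := ltn_expl (uphalf m) (isT : 1 < 2); lia.
have : 2 ^ uphalf m * 2 ^ m./2 = 2 ^ m by rewrite -expnD; congr (2 ^ _); lia.
move: (2 ^ uphalf m) (2 ^ m./2) (2 ^ 2 ^ j) split_m m4 => a b c split_m m4 ab mb cb.
(* The next two bounds combine to [6 * 2 + 3 * 4 = 24]. *)
have : m * c <= 2 * 2 ^ m by rewrite -ab; nia.
have : m * 2 ^ (m - j) <= 4 * 2 ^ m by rewrite -split_m; nia.
nia.
Qed.

(** * Random quadratic signs *)

Local Open Scope ring_scope.

(** The inner product over the field with two elements, in the ring structure of [bool]. *)
Definition dot n (r v : bitvec n) : bool := \sum_i r i * v i.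

Lemma dotC n (r v : bitvec n) : dot r v = dot v r.
Proof. by apply: eq_bigr => i _; rewrite mulrC. Qed.

Lemma dotDr n (r u v : bitvec n) : dot r (u + v) = dot r u + dot r v.
Proof. by rewrite /dot -big_split; apply: eq_bigr => i _ /=; rewrite !ffunE mulrDr. Qed.

Lemma dot0r n (r : bitvec n) : dot r 0 = false.
Proof. by rewrite /dot big1 // => i _; rewrite ffunE mulr0. Qed.

Lemma bitvDD n (v : bitvec n) : v + v = 0.
Proof. by apply/ffunP => i; rewrite !ffunE; case: (v i). Qed.

Lemma bitvD_eq0 n (u v : bitvec n) : (u + v == 0) = (u == v).
Proof.
apply/eqP/eqP => [uv0|->]; last exact: bitvDD.
by apply: (addIr v); rewrite uv0 bitvDD.
Qed.

Lemma signDb (R : realType) (b c : bool) :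
  (-1) ^+ (b + c)%R = (-1) ^+ b * (-1) ^+ c :> R.
Proof. exact: signr_addb. Qed.

Lemma sign_sum (R : realType) (I : finType) (F : I -> bool) :
  (-1) ^+ (\sum_i F i)%R = \prod_i (-1) ^+ F i :> R.
Proof.
by apply: (big_morph (fun b : bool => (-1) ^+ b : R)) => // b c; exact: signDb.
Qed.

(** Character orthogonality: the sum factors over coordinates, and a coordinate where [v] is 1
    contributes the factor 1 - 1. *)
Lemma sum_sign_dot (R : realType) n (v : bitvec n) :
  \sum_(r : bitvec n) (-1) ^+ dot r v
    = (v == 0)%:R * #|{: bitvec n}|%:R :> R.
Proof.
have [->|v0] := eqVneq v 0.
  under eq_bigr do rewrite dot0r.
  by rewrite sumr_const mul1r.
under eq_bigr do rewrite /dot sign_sum.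
rewrite -(bigA_distr_bigA (fun i (b : bool) => (-1) ^+ (b * v i)%R : R)).
have [i vi] : exists i, v i.
  apply/existsP; apply: contraNT v0; rewrite negb_exists => /forallP v0.
  by apply/eqP/ffunP => i; rewrite ffunE; apply/negbTE/v0.
by rewrite (bigD1 i) //= big_bool /= vi mulr0n /= addNr !mul0r.
Qed.

Definition quad n k (L : pairs n k) (v : bitvec n) : bool :=
  \sum_i dot (L i).1 v * dot (L i).2 v.

Definition smul n (b : bool) (v : bitvec n) := if b then v else 0.

Lemma dot_smul n (q v : bitvec n) b : dot q (smul b v) = b * dot q v.
Proof. by case: b; rewrite /= ?mul1r // mul0r dot0r. Qed.

(** For fixed [p] the exponent is linear in [q], so the sum over [q] vanishes unless its coefficient
    vector is 0. That vector is [(p.e) d + (p.d) e] with [d = x + y] and [e = x + z]: it is always 0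
    when [d] and [e] are dependent, and otherwise only when [p.d = p.e = 0], for a quarter of all
    [p]. *)
Lemma pair_moment4 (R : realType) n (x y z w : bitvec n) :
  x + y + z + w = 0 ->
  \sum_(pq : bitvec n * bitvec n)
     (-1) ^+ (dot pq.1 x * dot pq.2 x + dot pq.1 y * dot pq.2 y
              + dot pq.1 z * dot pq.2 z + dot pq.1 w * dot pq.2 w)%R
  = (if [|| x == y, x == z | y == z] then 1 else 4^-1)
    * #|{: bitvec n}|%:R ^+ 2 :> R.
Proof.
move=> /eqP; rewrite bitvD_eq0 => /eqP <-.
pose N : R := #|{: bitvec n}|%:R; rewrite -/N; pose d := x + y; pose e := x + z.
have innerE (p : bitvec n) : \sum_(q : bitvec n)
    (-1) ^+ (dot p x * dot q x + dot p y * dot q y + dot p z * dot q z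
             + dot p (x + y + z) * dot q (x + y + z))%R
    = (smul (dot p e) d + smul (dot p d) e == 0)%:R * N :> R.
  rewrite /N -sum_sign_dot; apply: eq_bigr => q _; congr (_ ^+ (nat_of_bool _)).
  rewrite [dot q (smul _ _ + _)]dotDr !dot_smul !dotDr.
  by case: (dot p x); case: (dot p y); case: (dot p z);
     case: (dot q x); case: (dot q y); case: (dot q z).
rewrite -(pair_bigA _ (fun p q => (-1) ^+ (dot p x * dot q x + dot p y * dot q y
  + dot p z * dot q z + dot p (x + y + z) * dot q (x + y + z))%R)) /=.
under eq_bigr do rewrite innerE.
rewrite -mulr_suml.
have d0E : (d == 0) = (x == y) by rewrite bitvD_eq0.
have e0E : (e == 0) = (x == z) by rewrite bitvD_eq0.
have deE : (d == e) = (y == z) by rewrite /d /e (inj_eq (addrI x)).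
rewrite -d0E -e0E -deE.
case: ifPn => [dep|].
  suff depE (p : bitvec n) : smul (dot p e) d + smul (dot p d) e = 0.
    by under eq_bigr do rewrite depE eqxx; rewrite sumr_const expr2 mul1r.
  case/or3P: dep => /eqP ->; rewrite ?dot0r /=.
  - by case: dot; rewrite /= addr0.
  - by case: dot; rewrite /= addr0.
  - by rewrite bitvDD.
rewrite !negb_or => /and3P[d0 e0 de].
(* The indicator of [p.d = p.e = 0] is the average of the characters of the four elements of the
   span of [d] and [e]. *)
have indicE (p : bitvec n) : (smul (dot p e) d + smul (dot p d) e == 0)%:R
    = 4^-1 * (1 + (-1) ^+ dot p d + (-1) ^+ dot p e + (-1) ^+ dot p (d + e)) :> R.
  rewrite dotDr; case: (dot p d); case: (dot p e); rewrite /= ?add0r ?addr0 ?eqxx /=.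
  - rewrite bitvD_eq0 (negbTE de) /= expr0; lra.
  - rewrite (negbTE e0) /= expr1 expr0; lra.
  - rewrite (negbTE d0) /= expr1 expr0; lra.
  - rewrite expr0; lra.
under eq_bigr do rewrite indicE.
rewrite -mulr_sumr !big_split /= !sum_sign_dot [d + e == 0]bitvD_eq0.
rewrite (negbTE d0) (negbTE e0) (negbTE de) sumr_const /= -/N.
by rewrite !mul0r !addr0 expr2 mulrA.
Qed.

Definition quad_sign (R : realType) n k
    (w : bitvec n * pairs n k) (v : bitvec n) : R :=
  (-1) ^+ (dot w.1 v + quad w.2 v)%R.

(** The linear part forces the four points to sum to 0, and the [k] independent pairs each
    contribute the factor of [pair_moment4]. *)
Lemma quad_sign_moment4 (R : realType) n k (x y z w : bitvec n) :
  \sum_o @quad_sign R n k o x * quad_sign R o y * quad_sign R o z * quad_sign R o w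
  = (x + y + z + w == 0)%:R
    * (if [|| x == y, x == z | y == z] then 1 else 4^-1 ^+ k)
    * #|{: bitvec n * pairs n k}|%:R.
Proof.
set N : R := #|{: bitvec n}|%:R.
have prodE (o : bitvec n * pairs n k) :
    quad_sign R o x * quad_sign R o y * quad_sign R o z * quad_sign R o w
    = (-1) ^+ dot o.1 (x + y + z + w) * \prod_i
     (-1) ^+ (dot (o.2 i).1 x * dot (o.2 i).2 x + dot (o.2 i).1 y * dot (o.2 i).2 y
              + dot (o.2 i).1 z * dot (o.2 i).2 z + dot (o.2 i).1 w * dot (o.2 i).2 w)%R.
  rewrite /quad_sign !dotDr -sign_sum.
  rewrite !big_split /= -/(quad o.2 x) -/(quad o.2 y) -/(quad o.2 z) -/(quad o.2 w).
  rewrite !signDb.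
  move: ((-1) ^+ dot o.1 x : R) ((-1) ^+ dot o.1 y : R) ((-1) ^+ dot o.1 z : R)
    ((-1) ^+ dot o.1 w : R) => a b c d.
  move: ((-1) ^+ quad o.2 x : R) ((-1) ^+ quad o.2 y : R) ((-1) ^+ quad o.2 z : R)
    ((-1) ^+ quad o.2 w : R) => a' b' c' d'.
  by ring.
under eq_bigr do rewrite prodE.
rewrite -(pair_bigA _ (fun (r : bitvec n)
    (L : pairs n k) => (-1) ^+ dot r (x + y + z + w) * \prod_i
     (-1) ^+ (dot (L i).1 x * dot (L i).2 x + dot (L i).1 y * dot (L i).2 y
              + dot (L i).1 z * dot (L i).2 z + dot (L i).1 w * dot (L i).2 w)%R)) /=.
rewrite -big_distrlr sum_sign_dot -/N.
have [s0|_] := eqVneq (x + y + z + w) 0; last by rewrite /= mulr0n !mul0r.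
rewrite /= mulr1n -(bigA_distr_bigA (fun (i : 'I_k) (pq : bitvec n * bitvec n) =>
  (-1) ^+ (dot pq.1 x * dot pq.2 x + dot pq.1 y * dot pq.2 y
              + dot pq.1 z * dot pq.2 z + dot pq.1 w * dot pq.2 w)%R)).
under eq_bigr do rewrite pair_moment4 //.
rewrite prodr_const card_ord.
rewrite card_prod [#|{: {ffun 'I_k -> _}}|]card_ffun card_prod card_ord.
rewrite natrM natrX natrM -/N.
case: ifP => _; rewrite ?mul1r; first by rewrite expr2 mulrC.
by rewrite exprMn expr2; ring.
Qed.

(** * Moments of random sign sums *)

Lemma expr4_sum (R : realType) (T : finType) (f : T -> R) :
  (\sum_x f x) ^+ 4 = \sum_x \sum_y \sum_z \sum_w f x * f y * f z * f w.
Proof.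
rewrite !exprS expr0 mulr1 mulr_suml; apply: eq_bigr => x _.
rewrite mulr_suml mulr_sumr; apply: eq_bigr => y _; rewrite mulrA.
rewrite mulr_suml mulr_sumr; apply: eq_bigr => z _; rewrite mulrA.
by rewrite mulr_sumr.
Qed.

Lemma sum_indic (R : realType) (T : finType) (f : T -> R) y :
  \sum_x (y == x)%:R * f x = f y.
Proof.
rewrite (bigD1 y) //= eqxx mul1r big1 ?addr0 // => x; rewrite eq_sym => /negbTE ->.
by rewrite mul0r.
Qed.

(** Parseval's identity. *)
Lemma second_moment_char (R : realType) (T : finType) n
    (phi : T -> bitvec n) (a : T -> R) :
  injective phi ->
  \sum_(r : bitvec n) (\sum_x a x * (-1) ^+ dot r (phi x)) ^+ 2
  = (\sum_x a x ^+ 2) * #|{: bitvec n}|%:R.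
Proof.
move=> phiI; under eq_bigr do rewrite expr2 mulr_suml.
rewrite exchange_big mulr_suml; apply: eq_bigr => x _.
under eq_bigr do rewrite mulr_sumr.
rewrite exchange_big /=.
transitivity (\sum_y (x == y)%:R * (a x * a y * #|{: bitvec n}|%:R)).
  apply: eq_bigr => y _; rewrite -(inj_eq phiI) -bitvD_eq0 mulrCA -sum_sign_dot.
  rewrite mulr_sumr; apply: eq_bigr => r _; rewrite dotDr signDb.
  by move: ((-1) ^+ _) ((-1) ^+ _) => A B; ring.
by rewrite sum_indic expr2.
Qed.

Lemma fourth_moment_quad_sign (R : realType) (T : finType) n k (phi : T -> bitvec n)
    (a : T -> R) (Lam : R) :
  injective phi ->
  (forall r, `|\sum_x a x * (-1) ^+ dot r (phi x)| <= Lam) ->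
  \sum_(o : bitvec n * pairs n k)
     (\sum_x a x * quad_sign R o (phi x)) ^+ 4
  <= (3 * (\sum_x a x ^+ 2) ^+ 2 + 4^-1 ^+ k * Lam ^+ 2 * \sum_x a x ^+ 2)
     * #|{: bitvec n * pairs n k}|%:R.
Proof.
move=> phiI aLam.
set S := \sum_x a x ^+ 2; set M : R := #|_|%:R; set eps := 4^-1 ^+ k.
pose F := \sum_x \sum_y \sum_z \sum_w
  (phi x + phi y + phi z + phi w == 0)%:R * (a x * a y * a z * a w).
have S0 : 0 <= S by apply: sumr_ge0 => x _; exact: sqr_ge0.
have eps1 : 0 <= eps <= 1 by rewrite exprn_ge0 ?exprn_ile1 //= ?invr_ge0 // invf_le1 // ler1n.
pose N : R := #|{: bitvec n}|%:R.
have N0 : 0 < N by rewrite ltr0n; apply/card_gt0P; exists 0.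
have secondmom : \sum_(r : bitvec n) (\sum_x a x * (-1) ^+ dot r (phi x)) ^+ 2 = S * N.
  exact: second_moment_char.
(* Expanding the condition of sum 0 into characters turns [F] into the mean fourth power of the
   Fourier coefficients. *)
have FN : F * N = \sum_(r : bitvec n) (\sum_x a x * (-1) ^+ dot r (phi x)) ^+ 4.
  under [RHS]eq_bigr do rewrite expr4_sum.
  rewrite [RHS]exchange_big mulr_suml; apply: eq_bigr => x _.
  rewrite [RHS]exchange_big mulr_suml; apply: eq_bigr => y _.
  rewrite [RHS]exchange_big mulr_suml; apply: eq_bigr => z _.
  rewrite [RHS]exchange_big mulr_suml; apply: eq_bigr => w _.
  rewrite mulrAC -sum_sign_dot mulr_suml; apply: eq_bigr => r _.
  rewrite !dotDr !signDb; set A := (-1) ^+ _; set B := (-1) ^+ _; set C := (-1) ^+ _.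
  set D := (-1) ^+ _; move: A B C D => A B C D; ring.
(* Two of the four powers are bounded by [Lam ^+ 2], and Parseval sums the other two. *)
have FS : F <= Lam ^+ 2 * S.
  rewrite -(ler_pM2r N0) FN -mulrA -secondmom mulr_sumr; apply: ler_sum => r _.
  rewrite -[4%N]/(2 + 2)%N exprD ler_wpM2r ?sqr_ge0 //.
  rewrite -[leLHS](real_normK (num_real _)) ler_pXn2r ?nnegrE ?normr_ge0 //.
  exact: le_trans (aLam r).
have key : \sum_(o : bitvec n * pairs n k)
    (\sum_x a x * quad_sign R o (phi x)) ^+ 4
  = (eps * F + (1 - eps) * (3 * S ^+ 2 - 2 * \sum_x a x ^+ 4)) * M.
  under eq_bigr do rewrite expr4_sum.
  (* The sign product has mean 1 on paired quadruples, eps on the other quadruples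
     of sum 0, and 0 elsewhere; paired ones are counted by inclusion-exclusion. *)
  transitivity (\sum_x \sum_y \sum_z \sum_w
    (eps * ((phi x + phi y + phi z + phi w == 0)%:R * (a x * a y * a z * a w)) + (1 - eps) *
     ((x == y)%:R * (z == w)%:R + (x == z)%:R * (y == w)%:R + (x == w)%:R * (y == z)%:R
       - 2 * ((x == y)%:R * (z == w)%:R * (x == z)%:R)) * (a x * a y * a z * a w)) * M).
    rewrite [LHS]exchange_big; apply: eq_bigr => x _.
    rewrite [LHS]exchange_big; apply: eq_bigr => y _.
    rewrite [LHS]exchange_big; apply: eq_bigr => z _.
    rewrite [LHS]exchange_big; apply: eq_bigr => w _.
    transitivity (a x * a y * a z * a w * ((phi x + phi y + phi z + phi w == 0)%:R
      * (if [|| phi x == phi y, phi x == phi z | phi y == phi z] then 1 else eps) * M)).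
      rewrite -quad_sign_moment4 mulr_sumr; apply: eq_bigr => o _.
      move: (quad_sign R o (phi x)) (quad_sign R o (phi y)).
      move: (quad_sign R o (phi z)) (quad_sign R o (phi w)).
      by move=> A B C D; ring.
    rewrite !(inj_eq phiI) [LHS]mulrA; congr (_ * M).
    (* Once two of the points coincide, sum 0 says that the other two coincide as well, so the
       quadruple is paired. *)
    have [<-|xy] := eqVneq x y.
      rewrite bitvDD add0r bitvD_eq0 (inj_eq phiI).
      have [<-|zw] := eqVneq z w; first by case: (x == z); rewrite /=; ring.
      have [->|xz] := eqVneq x z; last by rewrite /=; ring.
      by rewrite (negbTE zw) /=; ring.
    have [<-|xz] := eqVneq x z.
      rewrite [phi x + phi y + phi x]addrAC bitvDD add0r bitvD_eq0 (inj_eq phiI).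
      rewrite [y == x]eq_sym (negbTE xy).
      by case: (y == w); rewrite /=; ring.
    have [<-|yz] := eqVneq y z; last by rewrite /=; ring.
    rewrite -(addrA (phi x)) bitvDD addr0 bitvD_eq0 (inj_eq phiI).
    by case: (x == w); rewrite /=; ring.
  (* Carries the decomposition through one layer of summation; it is applied once for each of the
     four indices. *)
  have lin (A B C D E : T -> R) :
    (eps * (\sum_x A x)
     + (1 - eps) * (\sum_x B x + \sum_x C x + \sum_x D x - 2 * \sum_x E x)) * M
    = \sum_x (eps * A x + (1 - eps) * (B x + C x + D x - 2 * E x)) * M.
    by rewrite -mulr_suml !(big_split, =^~ mulr_sumr, sumrN).
  have Q1 : \sum_x \sum_y \sum_z \sum_w
      (x == y)%:R * (z == w)%:R * (a x * a y * a z * a w) = S ^+ 2.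
    rewrite expr2 mulr_suml; apply: eq_bigr => x _.
    transitivity (\sum_y (x == y)%:R * (a x * a y * S)); last by rewrite sum_indic expr2.
    apply: eq_bigr => y _; rewrite mulrA mulr_sumr; apply: eq_bigr => z _.
    transitivity (\sum_w (z == w)%:R * ((x == y)%:R * (a x * a y * (a z * a w)))).
      by apply: eq_bigr => w _; ring.
    by rewrite sum_indic expr2 mulrA.
  have Q2 : \sum_x \sum_y \sum_z \sum_w
      (x == z)%:R * (y == w)%:R * (a x * a y * a z * a w) = S ^+ 2.
    rewrite expr2 mulr_suml; apply: eq_bigr => x _.
    rewrite mulr_sumr; apply: eq_bigr => y _.
    transitivity (\sum_z (x == z)%:R * (a x * a z * a y ^+ 2)); last by rewrite sum_indic expr2.
    apply: eq_bigr => z _.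
    transitivity (\sum_w (y == w)%:R * ((x == z)%:R * (a x * a z * (a y * a w)))).
      by apply: eq_bigr => w _; ring.
    by rewrite sum_indic expr2.
  have Q3 : \sum_x \sum_y \sum_z \sum_w
      (x == w)%:R * (y == z)%:R * (a x * a y * a z * a w) = S ^+ 2.
    rewrite expr2 mulr_suml; apply: eq_bigr => x _.
    rewrite mulr_sumr; apply: eq_bigr => y _.
    transitivity (\sum_z (y == z)%:R * (a x ^+ 2 * (a y * a z))); last by rewrite sum_indic expr2.
    apply: eq_bigr => z _.
    transitivity (\sum_w (x == w)%:R * ((y == z)%:R * (a x * a w * (a y * a z)))).
      by apply: eq_bigr => w _; ring.
    by rewrite sum_indic expr2.
  have Q4 : \sum_x \sum_y \sum_z \sum_w
      (x == y)%:R * (z == w)%:R * (x == z)%:R * (a x * a y * a z * a w) = \sum_x a x ^+ 4.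
    apply: eq_bigr => x _.
    transitivity (\sum_y (x == y)%:R * (a x ^+ 3 * a y)); last by rewrite sum_indic -exprSr.
    apply: eq_bigr => y _.
    transitivity (\sum_z (x == z)%:R * ((x == y)%:R * (a x * a y * a z ^+ 2))); last first.
      by rewrite sum_indic; ring.
    apply: eq_bigr => z _.
    transitivity (\sum_w (z == w)%:R * ((x == y)%:R * (x == z)%:R * (a x * a y * a z * a w))).
      by apply: eq_bigr => w _; ring.
    by rewrite sum_indic; ring.
  rewrite -Q4 (_ : 3 * S ^+ 2 = S ^+ 2 + S ^+ 2 + S ^+ 2); last by ring.
  rewrite -{1}Q1 -{1}Q2 -Q3 lin; apply: eq_bigr => x _.
  rewrite lin; apply: eq_bigr => y _; rewrite lin; apply: eq_bigr => z _.
  rewrite lin; apply: eq_bigr => w _; congr (_ * _); ring.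
have a4 : 0 <= \sum_x a x ^+ 4.
  by apply: sumr_ge0 => x _; rewrite -[4%N]/(2 * 2)%N exprM sqr_ge0.
have M0 : 0 <= M by exact: ler0n.
rewrite key ler_wpM2r //.
have S2 := sqr_ge0 S.
have : eps * F <= eps * (Lam ^+ 2 * S) by apply: ler_wpM2l => //; lra.
have : (1 - eps) * (3 * S ^+ 2 - 2 * \sum_x a x ^+ 4) <= 1 * (3 * S ^+ 2).
  case/andP: eps1 => e0 e1.
  apply: le_trans (_ : (1 - eps) * (3 * S ^+ 2) <= _).
    by apply: ler_wpM2l; lra.
  by apply: ler_wpM2r; lra.
by rewrite -mulrA; lra.
Qed.

(** For fixed [L] the quadratic sign is absorbed into [a] without changing any square, and Parseval
    applies to the sum over [r]. *)
Lemma second_moment_quad_sign (R : realType) (T : finType) n k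
    (phi : T -> bitvec n) (a : T -> R) :
  injective phi ->
  \sum_(o : bitvec n * pairs n k)
     (\sum_x a x * quad_sign R o (phi x)) ^+ 2
  = (\sum_x a x ^+ 2)
    * #|{: bitvec n * pairs n k}|%:R.
Proof.
move=> phiI; rewrite -(pair_bigA _ (fun (r : bitvec n)
  (L : pairs n k) =>
  (\sum_x a x * quad_sign R (r, L) (phi x)) ^+ 2)) exchange_big /=.
rewrite card_prod natrM mulrA.
transitivity (\sum_(L : pairs n k)
  (\sum_x a x ^+ 2) * #|{: bitvec n}|%:R); last by rewrite sumr_const -[LHS]mulr_natr.
apply: eq_bigr => L _.
rewrite (eq_bigr (fun x => (a x * (-1) ^+ quad L (phi x)) ^+ 2)); last first.
  by move=> x _; rewrite exprMn sqrr_sign mulr1.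
rewrite -(second_moment_char _ phiI); apply: eq_bigr => r _; congr (_ ^+ 2).
by apply: eq_bigr => x _; rewrite /quad_sign signDb mulrA mulrAC.
Qed.

(** The absolute value is bounded below pointwise by a combination of the square and the fourth
    power, whose means are known. *)
Lemma first_moment_quad_sign (R : realType) (T : finType) n k
    (phi : T -> bitvec n) (a : T -> R) (Lam : R) :
  injective phi -> 0 < Lam ->
  (forall r, `|\sum_x a x * (-1) ^+ dot r (phi x)| <= Lam) ->
  (Num.sqrt (\sum_x a x ^+ 2) / 2 - 2^-1 ^+ k * Lam / 4)
    * #|{: bitvec n * pairs n k}|%:R
  <= \sum_(o : bitvec n * pairs n k)
     `|\sum_x a x * quad_sign R o (phi x)|.
Proof.
move=> phiI Lam0 aLam; set S := \sum_x a x ^+ 2; set sigma := Num.sqrt S.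
set M : R := #|_|%:R; set delta := 2^-1 ^+ k * Lam.
have S0 : 0 <= S by apply: sumr_ge0 => x _; exact: sqr_ge0.
have SE : S = sigma ^+ 2 by rewrite sqr_sqrtr.
have sigma0 : 0 <= sigma by exact: sqrtr_ge0.
have delta0 : 0 < delta by rewrite mulr_gt0 // exprn_gt0 // invr_gt0.
have M0 : 0 <= M by exact: ler0n.
(* The scale of comparison is of order [sigma]; adding [delta] keeps it positive when [sigma = 0]
   and makes the remainder below a sum of nonnegative terms. *)
pose lam := 2 * sigma + delta; have lam0 : 0 < lam by rewrite /lam; lra.
have delta2 : 4^-1 ^+ k * Lam ^+ 2 = delta ^+ 2.
  rewrite /delta exprMn -exprM mulnC exprM; congr (_ ^+ _ * _).
  by rewrite exprVn -natrX.
have mom2 := second_moment_quad_sign k a phiI.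
have mom4 := fourth_moment_quad_sign k phiI aLam.
rewrite -/S -/M in mom2 mom4.
pose X (o : bitvec n * pairs n k) :=
  \sum_x a x * quad_sign R o (phi x).
(* [3 u^2 - u^4 <= 2 u] for [u >= 0], applied to [u = `|X o| / lam] *)
have pointwise o : 3 / (2 * lam) * X o ^+ 2 - (2 * lam ^+ 3)^-1 * X o ^+ 4 <= `|X o|.
  rewrite -(real_normK (num_real (X o))) -[4%N]/(2 * 2)%N exprM -(real_normK (num_real (X o))).
  pose u := `|X o| / lam.
  have u0 : 0 <= u by rewrite divr_ge0 // ltW.
  have -> : `|X o| = lam * u by rewrite /u mulrCA mulfV ?mulr1 // gt_eqF.
  have -> : 3 / (2 * lam) * (lam * u) ^+ 2 - (2 * lam ^+ 3)^-1 * (lam * u) ^+ 2 ^+ 2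
    = lam * u - lam / 2 * (u * ((u - 1) ^+ 2 * (u + 2))).
    by field; rewrite gt_eqF.
  rewrite gerBl; apply: mulr_ge0; first lra.
  by rewrite mulr_ge0 // mulr_ge0 ?sqr_ge0 //; lra.
apply: le_trans (ler_sum _ (fun o _ => pointwise o)).
rewrite big_split /= sumrN -!mulr_sumr /X mom2.
apply: le_trans (_ : 3 / (2 * lam) * (S * M) - (2 * lam ^+ 3)^-1 *
    ((3 * S ^+ 2 + 4^-1 ^+ k * Lam ^+ 2 * S) * M) <= _); last first.
  rewrite lerD2l lerN2 ler_wpM2l // invr_ge0 mulr_ge0 // exprn_ge0 //; exact: ltW.
rewrite delta2 SE.
have -> : 3 / (2 * lam) * (sigma ^+ 2 * M) - (2 * lam ^+ 3)^-1 *
    ((3 * (sigma ^+ 2) ^+ 2 + delta ^+ 2 * sigma ^+ 2) * M)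
  = (sigma / 2 - delta / 4) * M
    + M * (sigma ^+ 2 * (sigma ^+ 2 + 4 * sigma * delta) / (2 * lam ^+ 3)
           + delta ^+ 2 / (4 * lam)).
  by rewrite /lam; field; rewrite gt_eqF.
have [lam_ge0 delta_ge0] := (ltW lam0, ltW delta0).
rewrite lerDl; repeat first [assumption | exact: ler0n | apply: exprn_ge0
  | apply: mulr_ge0 | apply: addr_ge0 | rewrite invr_ge0].
Qed.

(** * From moments to a good predictor *)

Lemma bucket_cauchy (R : realType) (T : finType) (P : pred T) (a : T -> R) (D : R) :
  0 < D -> #|P|%:R <= D ->
  (\sum_(x | P x) `|a x|) / Num.sqrt D <= Num.sqrt (\sum_(x | P x) a x ^+ 2).
Proof.
move=> D0 PD; set h := \sum_(x | P x) `|a x|; set S := \sum_(x | P x) _.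
have h0 : 0 <= h by exact: sumr_ge0.
(* Expanding these squares gives Cauchy-Schwarz with the upper bound [D] in place of the cardinality
   of [P]. *)
have : 0 <= \sum_(x | P x) (`|a x| - h / D) ^+ 2 by apply: sumr_ge0 => x _; exact: sqr_ge0.
have -> : \sum_(x | P x) (`|a x| - h / D) ^+ 2 = S - 2 * (h / D) * h + (h / D) ^+ 2 * #|P|%:R.
  transitivity (\sum_(x | P x) (a x ^+ 2 - 2 * (h / D) * `|a x| + (h / D) ^+ 2)).
    by apply: eq_bigr => x _; rewrite sqrrB real_normK ?num_real //; ring.
  by rewrite !big_split /= sumrN -mulr_sumr sumr_const mulr_natr.
move=> sq; rewrite ler_pdivrMr ?sqrtr_gt0 // -sqrtrM; last first.
  by apply: sumr_ge0 => x _; exact: sqr_ge0.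
rewrite -[leLHS]ger0_norm // -sqrtr_sqr ler_wsqrtr //.
have hD0 : 0 <= (h / D) ^+ 2 by exact: sqr_ge0.
have := ler_wpM2l hD0 PD.
have hDE : h = h / D * D by rewrite divfK // gt_eqF.
move: hDE sq; set c := h / D => hDE sq cD.
rewrite [leLHS](_ : _ = (2 * c * h - c ^+ 2 * D) * D); last by rewrite hDE; ring.
by rewrite ler_pM2r //; lra.
Qed.

Lemma exists_good_quad_sign (R : realType) (T B : finType) n k
    (phi : T -> bitvec n) (beta : T -> B) (a : T -> R) (Lam D : R) :
  injective phi -> (#|B| <= 2 ^ k)%N ->
  0 < D -> (forall b, #|[pred x | beta x == b]|%:R <= D) ->
  \sum_x `|a x| = 1 -> 0 < Lam -> 25 * Lam ^+ 2 * D <= 4 ->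
  exists o : bitvec n * pairs n k,
    Lam <= \sum_b `|\sum_(x | beta x == b) a x * quad_sign R o (phi x)|.
Proof.
move=> phiI Bk D0 BD a1 Lam0 LamD.
pose Om : finType := (bitvec n * pairs n k)%type.
pose Tot (o : Om) := \sum_b `|\sum_(x | beta x == b) a x * quad_sign R o (phi x)|.
have [/existsP//|/existsPn none] := boolP [exists o : Om, Lam <= Tot o].
exfalso; pose M : R := #|Om|%:R.
have Om_gt0 : (0 < #|Om|)%N by apply/card_gt0P; exists (0, [ffun => (0, 0)]).
have M0 : 0 < M by rewrite ltr0n.
have lt_Lam o : Tot o < Lam by rewrite ltNge.
(* Extending by 0 outside the bucket lets the moment bounds, which sum over all of [T], apply to
   each bucket. *)
pose ab b x := (if beta x == b then a x else 0).
have abE b (g : T -> R) : \sum_x ab b x * g x = \sum_(x | beta x == b) a x * g x.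
  by rewrite [RHS]big_mkcond; apply: eq_bigr => x _; rewrite /ab; case: ifP; rewrite ?mul0r.
have chi_le b r : `|\sum_x ab b x * (-1) ^+ dot r (phi x)| <= Lam.
  (* With all pairs zero the sign is the character of [r], and a single bucket contributes at most
     the total. *)
  apply: le_trans (ltW (lt_Lam (r, [ffun => (0, 0)]))).
  rewrite /Tot (bigD1 b) //= abE -[leLHS]addr0 lerD ?sumr_ge0 // le_eqVlt.
  apply/orP; left; apply/eqP; congr `|_|; apply: eq_bigr => x _; rewrite /quad_sign /quad.
  by rewrite big1 ?addr0 // => i _; rewrite ffunE dotC dot0r mul0r.
have low : (\sum_b (Num.sqrt (\sum_x ab b x ^+ 2) / 2 - 2^-1 ^+ k * Lam / 4)) * M
    <= \sum_(o : Om) Tot o.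
  rewrite /Tot exchange_big mulr_suml; apply: ler_sum => b _.
  apply: le_trans (first_moment_quad_sign k phiI Lam0 (chi_le b)) _.
  by apply: ler_sum => o _; rewrite abE.
have up : \sum_(o : Om) Tot o < Lam * M.
  rewrite mulr_natr -sumr_const; apply: ltr_sum => [|o _]; last exact: lt_Lam.
  by apply/hasP; exists (0, [ffun => (0, 0)]); rewrite ?mem_index_enum.
have := le_lt_trans low up; rewrite ltr_pM2r //.
rewrite big_split /= -mulr_suml sumrN.
have sq_ge : (Num.sqrt D)^-1 <= \sum_b Num.sqrt (\sum_x ab b x ^+ 2).
  rewrite -[leLHS]mul1r -a1 (partition_big beta xpredT) //= mulr_suml.
  apply: ler_sum => b _; have /le_trans := bucket_cauchy a D0 (BD b); apply.
  rewrite ler_wsqrtr // [leLHS]big_mkcond; apply: ler_sum => x _.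
  by rewrite /ab /=; case: ifP => //; rewrite expr0n.
(* With at most [2 ^ k] buckets, the error terms add up to at most [Lam / 4]. *)
have Bk1 : #|B|%:R * 2^-1 ^+ k <= 1 :> R.
  by rewrite exprVn ler_pdivrMr ?exprn_gt0 // mul1r -natrX ler_nat.
have sqrtD0 : 0 < Num.sqrt D by rewrite sqrtr_gt0.
have LamD' : Lam * 5 * Num.sqrt D <= 2.
  have lhs0 : 0 <= Lam * 5 * Num.sqrt D by rewrite !mulr_ge0 // ltW.
  rewrite -ler_sqr ?nnegrE // !exprMn (sqr_sqrtr (ltW D0)); lra.
(* So half of the inverse root of [D] is at least [5 * Lam / 4], and subtracting the error [Lam / 4]
   leaves [Lam]. *)
have Lam_le : Lam * 5 <= 2 * (Num.sqrt D)^-1 by rewrite ler_pdivlMr.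
have delta_sum : \sum_(b : B) 2^-1 ^+ k * Lam / 4 <= Lam / 4.
  rewrite sumr_const; apply: le_trans (_ : Lam * (#|B|%:R * 2^-1 ^+ k) / 4 <= _).
    rewrite le_eqVlt; apply/orP; left; apply/eqP; rewrite -[LHS]mulr_natr.
    by rewrite mulrC !mulrA; congr (_ / 4); rewrite [Lam * _]mulrC mulrAC.
  by rewrite ler_pM2r ?invr_gt0 // -[leRHS]mulr1; apply: ler_wpM2l => //; exact: ltW.
set s := \sum_b Num.sqrt _ in sq_ge *; set t := \sum_b _ in delta_sum *.
lra.
Qed.

Lemma exists_good_predictor (R : realType) (T B : finType) n k
    (phi : T -> bitvec n) (beta : T -> B) (f : T -> bool)
    (H : {ffun T -> R}) (gamma D : R) :
  injective phi -> (#|B| <= 2 ^ k)%N ->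
  0 < D -> (forall b, #|[pred x | beta x == b]|%:R <= D) ->
  is_distribution H -> 0 < gamma -> 25 * gamma ^+ 2 * D <= 1 ->
  exists (o : bitvec n * pairs n k)
         (tau : B -> bool),
    1 / 2 + gamma
      <= Pr H (fun x => ((dot o.1 (phi x) + quad o.2 (phi x))%R (+) tau (beta x)) == f x).
Proof.
move=> phiI Bk D0 BD [H0 H1] gamma0 gammaD.
pose a x := H x * (-1) ^+ f x.
have a1 : \sum_x `|a x| = 1.
  by rewrite -H1; apply: eq_bigr => x _; rewrite normrM normr_sign mulr1 ger0_norm.
have [||o good] := exists_good_quad_sign phiI Bk D0 BD a1 (Lam := 2 * gamma); try lra.
exists o; pose X b := \sum_(x | beta x == b) a x * quad_sign R o (phi x).
(* Flipping the prediction exactly on the buckets of negative correlation turns each [X b] into its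
   absolute value. *)
exists (fun b => X b < 0); pose s x : bool := (dot o.1 (phi x) + quad o.2 (phi x))%R.
have sumX : \sum_b `|X b| = \sum_x (-1) ^+ (X (beta x) < 0)%R * (a x * quad_sign R o (phi x)).
  rewrite [RHS](partition_big beta xpredT) //=; apply: eq_bigr => b _.
  transitivity ((-1) ^+ (X b < 0)%R * X b).
    by case: ltrP => X0 /=; [rewrite expr1 mulN1r ltr0_norm | rewrite expr0 mul1r ger0_norm].
  by rewrite mulr_sumr; apply: eq_bigr => x /eqP ->.
have PrE : 2 * Pr H (fun x => (s x (+) (X (beta x) < 0)) == f x) = 1 + \sum_b `|X b|.
  rewrite /Pr big_mkcond mulr_sumr -[X in _ = X + _]H1 sumX -big_split /=; apply: eq_bigr => x _.
  rewrite /a /quad_sign -/(s x).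
  have eqbE (u v : bool) : (u == v) = ~~ (u (+) v) by case: u v => [] [].
  rewrite eqbE; move: (s x) (X _ < 0)%R (f x) => [] [] [] /=; rewrite ?expr0 ?expr1; ring.
rewrite /X in PrE; lra.
Qed.

(** * Circuits for linear and quadratic forms *)

Local Open Scope nat_scope.

Definition bits n (x : n.-tuple bool) : bitvec n := [ffun i => tnth x i].

Lemma bits_inj n : injective (@bits n).
Proof.
move=> x y /ffunP xy; apply: eq_from_tnth => i; by have := xy i; rewrite !ffunE.
Qed.

Lemma input_mem n (i : 'I_n) A : input i \in inputs n ++ A.
Proof. by rewrite mem_cat map_f ?mem_enum. Qed.

(* The sums over each type cost n + |V| gates once; afterwards every form that is
   constant on types is a sum of at most |V| wires. *)
Lemma computes_typed_sums n (V : finType) (ty : 'I_n -> V) (Ps : seq {set V}) :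
  0 < n ->
  computes [::] (n + #|V| + #|V|.+1 * size Ps)
    [seq [ffun x : n.-tuple bool => (\sum_(j | ty j \in P) tnth x j)%R] | P : {set V} <- Ps].
Proof.
move=> n0; pose y v := [ffun x : n.-tuple bool => (\sum_(j | ty j == v) tnth x j)%R].
have cy v : computes [::] #|[pred j | ty j == v]|.+1 [:: y v].
  pose F := [seq input j | j <- enum [pred j | ty j == v]].
  have Fin : {subset F <= inputs n ++ [::]} by move=> h /mapP[j _ ->]; exact: input_mem.
  rewrite cardE -(size_map (@input n)) -/F.
  rewrite (_ : y v = [ffun x => (\sum_(f <- F) f x)%R]); first exact: computes_xor.
  apply/ffunP => x; rewrite !ffunE big_map big_enum.
  by apply: eq_bigr => j _; rewrite ffunE.
have cys : computes [::] (n + #|V|) [seq y v | v <- enum V].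
  rewrite (_ : n + #|V| = \sum_(v <- enum V) #|[pred j | ty j == v]|.+1).
    by apply: computes_map => v _; exact: cy.
  (* The types partition the [n] inputs, and each type pays one further gate. *)
  rewrite big_enum; under eq_bigr do rewrite -addn1.
  rewrite big_split /= sum1_card; congr (_ + _).
  rewrite -[LHS]card_ord -sum1_card (partition_big ty predT) //=.
  by apply: eq_bigr => v _; rewrite sum1_card.
apply: computes_sub (computes_cat cys (computes_all (c := #|V|.+1)
  (G := [seq [ffun x : n.-tuple bool => (\sum_(j | ty j \in P) tnth x j)%R]
        | P : {set V} <- Ps]) _)) => //.
- by rewrite size_map.
- by move=> h hG; rewrite !mem_cat hG !orbT.
move=> g /mapP[P _ ->]; pose F := [seq y v | v <- enum P].
have FA : {subset F <= inputs n ++ [::] ++ [seq y v | v <- enum V]}.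
  by move=> h /mapP[v _ ->]; rewrite !mem_cat (map_f y) ?mem_enum ?orbT.
apply: computes_sub (computes_xor n0 FA) => // [h||h].
- by rewrite !mem_cat => ->; rewrite orbT.
- by rewrite size_map -cardE ltnS max_card.
rewrite !inE => /eqP ->; rewrite !mem_cat !inE; apply/orP; right; apply/orP; right.
apply/eqP/ffunP => x; rewrite !ffunE big_map big_enum.
rewrite (partition_big ty (mem P)) //=; apply: eq_bigr => v Pv; rewrite ffunE.
by apply: eq_bigl => j; case: eqP => [->|]; rewrite ?andbF ?andbT.
Qed.

(** The type of an input is its vector of coefficients in the [2 * c] forms. There are [4 ^ c]
    types, and each form sums the inputs whose type lies in a fixed set. *)
Lemma computes_quad_small n c (L : pairs n c) :
  0 < n ->
  computes [::] (n + 4 ^ c + (4 ^ c).+1 * (c + c) + c + c.+1)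
    [:: [ffun x : n.-tuple bool => quad L (bits x)]].
Proof.
move=> n0; pose V : finType := {ffun 'I_c -> bool * bool}.
pose ty j : V := [ffun i => ((L i).1 j, (L i).2 j)].
pose Ps : seq {set V} := [seq [set t : V | (t i).1] | i <- enum 'I_c]
                       ++ [seq [set t : V | (t i).2] | i <- enum 'I_c].
pose p i := [ffun x : n.-tuple bool => dot (L i).1 (bits x)].
pose q i := [ffun x : n.-tuple bool => dot (L i).2 (bits x)].
pose A := [seq p i | i <- enum 'I_c] ++ [seq q i | i <- enum 'I_c].
have cA : computes [::] (n + 4 ^ c + (4 ^ c).+1 * (c + c)) A.
  have := computes_typed_sums ty Ps n0.
  rewrite /Ps card_ffun card_prod card_bool card_ord size_cat !size_map -enumT size_enum_ord.
  rewrite map_cat; congr (computes _ _ (_ ++ _)); rewrite -[LHS]map_comp; apply: eq_map => i;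
  apply/ffunP => x; rewrite !ffunE /dot big_mkcond; apply: eq_bigr => j _;
  by rewrite inE !ffunE /=; case: (_ j); rewrite ?mul1r ?mul0r.
pose r i := [ffun x => andb (p i x) (q i x)].
have cr : computes A c [seq r i | i <- enum 'I_c].
  have cE : \sum_(i <- enum 'I_c) 1 = c by rewrite big_enum sum1_card card_ord.
  rewrite -[X in computes A X _]cE.
  apply: computes_map => i _; apply: (computes_gate andb);
  by rewrite !mem_cat map_f ?mem_enum ?orbT.
have cq : computes (A ++ [seq r i | i <- enum 'I_c]) c.+1
    [:: [ffun x => (\sum_(f <- [seq r i | i <- enum 'I_c]) f x)%R]].
  have cE : size [seq r i | i <- enum 'I_c] = c by rewrite size_map size_enum_ord.
  rewrite -[X in computes _ X.+1 _]cE.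
  by apply: computes_xor => // h hr; rewrite !mem_cat hr !orbT.
have cAr : computes [::] (n + 4 ^ c + (4 ^ c).+1 * (c + c) + c) (A ++ [seq r i | i <- enum 'I_c]).
  exact: computes_cat cA cr.
apply: computes_sub (computes_cat cAr cq) => // h.
rewrite inE => /eqP ->; rewrite [X in X \in _](_ : _ =
  [ffun x => (\sum_(f <- [seq r i | i <- enum 'I_c]) f x)%R]).
  by rewrite !mem_cat !inE eqxx !orbT.
apply/ffunP => x; rewrite !ffunE /quad big_map big_enum.
by apply: eq_bigr => i _; rewrite !ffunE.
Qed.

Lemma quad_split n c d (L : pairs n (c + d)) v :
  quad L v = addb (quad [ffun i => L (lshift d i)] v) (quad [ffun i => L (rshift c i)] v).
Proof.
by rewrite /quad big_split_ord; congr addb; apply: eq_bigr => i _; rewrite ffunE.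
Qed.

(** Four groups of [c] pairs keep the number of types at [4 ^ c] per group; three gates add the
    results. *)
Lemma computes_quad n c (L : pairs n (c + c + (c + c))) :
  0 < n ->
  computes [::] (4 * (n + 4 ^ c + (4 ^ c).+1 * (c + c) + c + c.+1) + 3)
    [:: [ffun x : n.-tuple bool => quad L (bits x)]].
Proof.
move=> n0.
have addE k l (L' : pairs n (k + l)) :
    [ffun x : n.-tuple bool => quad L' (bits x)]
    = [ffun x => addb ([ffun x : n.-tuple bool => quad [ffun i => L' (lshift l i)] (bits x)] x)
                      ([ffun x : n.-tuple bool => quad [ffun i => L' (rshift k i)] (bits x)] x)].
  by apply/ffunP => x; rewrite !ffunE quad_split.
set s := n + _ + _ + _ + _.
have -> : 4 * s + 3 = ((s + s).+1 + (s + s).+1).+1 by lia.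
by rewrite addE; apply: computes_gate_of; rewrite addE; apply: computes_gate_of;
  exact: computes_quad_small.
Qed.

Lemma computes_dot n (r : bitvec n) :
  0 < n -> computes [::] n.+1 [:: [ffun x : n.-tuple bool => dot r (bits x)]].
Proof.
move=> n0; pose F := [seq @input n j | j <- enum [pred j | r j]].
have Fin : {subset F <= inputs n ++ [::]} by move=> h /mapP[j _ ->]; exact: input_mem.
apply: computes_sub (computes_xor n0 Fin) => // [|h].
  by rewrite size_map -cardE ltnS (leq_trans (max_card _)) // card_ord.
rewrite !inE => /eqP ->; rewrite [X in X \in _](_ : _ = [ffun x => (\sum_(f <- F) f x)%R]).
  by rewrite !mem_cat !inE eqxx !orbT.
apply/ffunP => x; rewrite !ffunE /dot big_map big_enum [RHS]big_mkcond.
apply: eq_bigr => j _; rewrite !ffunE inE; case: (r j); by rewrite ?mul1r ?mul0r.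
Qed.

Lemma table_circuit n (f : n.-tuple bool -> bool) :
  0 < n -> exists C : circuit n, circuit_size C * n <= 24 * 2 ^ n /\ circuit_eval C =1 f.
Proof.
move=> n0; pose tau (s : seq bool) := f [tuple nth false s i | i < n].
(* The default of [nth] in [tau] is never reached, as the list of input values has length [n]. *)
have [s cs sn] := @computes_lookup n [::] (inputs n) tau n0 (mem_subseq (prefix_subseq _ _)).
move: sn; rewrite size_map size_enum_ord => sn.
have [C [Cs CE]] := computes_circuit cs; exists C; split.
  by apply: leq_trans sn; rewrite leq_mul2r Cs orbT.
move=> x; rewrite CE ffunE /tau; congr f; apply: eq_from_tnth => i.
rewrite tnth_mktuple -map_comp (nth_map i) ?size_enum_ord //.
by rewrite nth_ord_enum /= ffunE.
Qed.

Lemma predictor_circuit n m (mn : m <= n) c (r : bitvec n)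
    (L : pairs n (c + c + (c + c)))
    (tau : m.-tuple bool -> bool) :
  0 < m -> c = (m %/ 4).+1 ->
  exists C : circuit n, circuit_size C * m <= 12 * n * m + 4000 * 2 ^ m
    /\ forall x, circuit_eval C x
         = (dot r (bits x) + quad L (bits x))%R (+) tau [tuple tnth x (widen_ord mn i) | i < m].
Proof.
move=> m0 cE; have n0 : 0 < n by exact: leq_trans mn.
pose tau' (s : seq bool) := tau [tuple nth false s i | i < m].
pose vs := [seq input (widen_ord mn i) | i <- enum 'I_m].
have vsP : {subset vs <= inputs n ++ [::]} by move=> h /mapP[i _ ->]; exact: input_mem.
have [s cs] := computes_lookup tau' n0 vsP.
rewrite size_map size_enum_ord => sm.
have := computes_gate_of addb (computes_gate_of addb (computes_dot r n0) (computes_quad L n0)) cs.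
move=> /computes_circuit[C [Cs CE]]; exists C; split; last first.
  move=> x; rewrite CE !ffunE; congr (_ (+) tau _); apply: eq_from_tnth => i.
  rewrite !tnth_mktuple -map_comp (nth_map i) ?size_enum_ord //.
  by rewrite nth_ord_enum /= ffunE.
set q := m %/ 4 in cE.
have q4 : 4 ^ c = 4 * 4 ^ q by rewrite cE expnS.
have m4 : m <= 4 * 2 ^ q by have := ltn_expl q (isT : 1 < 2); lia.
have e2 : 2 ^ q * 2 ^ q = 4 ^ q by rewrite -expnMn.
have e4 : 4 ^ q * 4 ^ q <= 2 ^ m.
  rewrite -expnMn -[4 * 4]/(2 ^ 4) -expnM leq_pexp2l //; lia.
apply: leq_trans (leq_mul Cs (leqnn m)) _; rewrite q4.
have cm : c <= m by lia.
have m2 : m < 2 ^ m by exact: ltn_expl.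
have Q0 : 0 < 4 ^ q by rewrite expn_gt0.
move: (4 ^ q) (2 ^ q) (2 ^ m) m4 e2 e4 sm m2 Q0 => Q P M mP PQ QM sm mM Q0.
(* Here [Q = 4 ^ q], [P = 2 ^ q] and [M = 2 ^ m]. From [m <= 4 * P] and [Q * Q <= M], even the
   dominant term, of order [Q * c * m], is of order [M]. *)
have mm : m * m <= 16 * Q by nia.
have cmQ : c * m <= 16 * Q by nia.
have mQ : m <= 16 * Q by nia.
have QmM : Q * m <= 16 * M by nia.
have QcmM : Q * (c * m) <= 16 * M by nia.
have QM' : Q <= M by nia.
clear mP PQ QM mm Q0; lia.
Qed.

(** * The predictor *)

Local Open Scope ring_scope.

(** A point with a given prefix is determined by its last [n - m] bits. *)
Lemma card_prefix_fiber n m (mn : (m <= n)%N) (b : m.-tuple bool) :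
  (#|[pred x : n.-tuple bool | [tuple tnth x (widen_ord mn i) | i < m] == b]| <= 2 ^ (n - m))%N.
Proof.
set P := [pred x | _]; pose g (x : n.-tuple bool) := [tuple nth false x (m + i) | i < n - m].
have gI : {in P &, injective g}.
  move=> x y /eqP xb /eqP yb gxy; apply: eq_from_tnth => i.
  have [im|mi] := ltnP i m.
    have -> : i = widen_ord mn (Ordinal im) by exact: val_inj.
    move: xb; rewrite -yb => /(congr1 (fun t => tnth t (Ordinal im))).
    by rewrite !tnth_mktuple.
  have imn : (i - m < n - m)%N by rewrite ltn_sub2r // (leq_ltn_trans mi).
  have := congr1 (fun t => tnth t (Ordinal imn)) gxy.
  by rewrite !tnth_mktuple /= subnKC // !(tnth_nth false).
by rewrite -(card_in_image gI) (leq_trans (max_card _)) // card_tuple card_bool.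
Qed.

Lemma log2_le (R : realType) (x : R) (m : nat) :
  0 < x -> x <= 2 ^+ m -> log2 x <= m%:R.
Proof.
move=> x0 xm; have ln2 : 0 < ln 2 :> R by rewrite ln_gt0 // ltr1n.
rewrite /log2 ler_pdivrMr // mulr_natl -lnXn //.
by rewrite ler_ln // posrE // exprn_gt0.
Qed.

Lemma log2_gt0 (R : realType) (x : R) : 1 < x -> 0 < log2 x.
Proof. by move=> x1; rewrite divr_gt0 // ln_gt0 // ltr1n. Qed.

(** Rounding up gives [4 * c >= m], so there are enough pairs for the number of buckets. *)
Lemma card_tuple_le_quarters m (c := (m %/ 4).+1) :
  (#|{: m.-tuple bool}| <= 2 ^ (c + c + (c + c)))%N.
Proof. by rewrite card_tuple card_bool leq_exp2l // /c; lia. Qed.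

Theorem theorem1p5 (R : realType) :
  exists K : R, 0 < K /\
    forall (n : nat) (f : n.-tuple bool -> bool) (gamma : R)
           (H : {ffun n.-tuple bool -> R}),
      27 / (2 `^ (n%:R / 2)) < gamma -> gamma < 1 / 2 ->
      is_distribution H ->
      exists C : circuit n,
        (circuit_size C)%:R <=
          K * (gamma ^+ 2 * 2 ^+ n / log2 (gamma ^+ 2 * 2 ^+ n) + n%:R)
        /\ 1 / 2 + gamma <= Pr H (fun x => circuit_eval C x == f x).
Proof.
(* The product is [4000 * 50]: the constant of [predictor_circuit] times the bound
   [2 ^+ m < 50 * N]. *)
exists (500 * 400); split; first by rewrite mulr_gt0 // ltr0n.
move=> n f gamma H gamma_gt gamma_lt distH.
set N := gamma ^+ 2 * 2 ^+ n.
have p0 : 0 < 2 `^ (n%:R / 2) :> R by rewrite powR_gt0.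
have pp : (2 `^ (n%:R / 2)) ^+ 2 = 2 ^+ n :> R.
  rewrite expr2 -powRD; last by rewrite pnatr_eq0 implybT.
  by rewrite -powR_mulrn //; congr (_ `^ _); lra.
have gp : 27 < gamma * 2 `^ (n%:R / 2) by rewrite -ltr_pdivrMr.
have gamma0 : 0 < gamma by apply: lt_trans gamma_gt; rewrite divr_gt0.
have N_gt : 729 < N.
  rewrite /N -pp -exprMn (_ : 729 = 27 ^+ 2); last by ring.
  by rewrite ltr_pXn2r // nnegrE; lra.
have pow0 : 0 < 2 ^+ n :> R by rewrite exprn_gt0.
have gamma2 : gamma ^+ 2 < 1 / 4 by rewrite expr2; nra.
have N_lt : 4 * N < 2 ^+ n by rewrite /N; nra.
have n0 : (0 < n)%N.
  by case: (posnP n) N_lt => // ->; rewrite expr0; lra.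
have N0 : 0 < N by lra.
have log_gt0 : 0 < log2 N by apply: log2_gt0; lra.
have Nlog m : N <= 2 ^+ m -> N / m%:R <= N / log2 N.
  move=> Nm; have lm := log2_le N0 Nm.
  by rewrite ler_pM2l // lef_pV2 // posrE // (lt_le_trans log_gt0).
(* Since [4 * N < 2 ^+ n], the power [2 ^+ (n + 5)] exceeds [25 * N]. *)
have ex_m : exists m, 25 * N <= 2 ^+ m by exists (n + 5)%N; rewrite exprD; lra.
have [m Nm min_m] := ex_minnP ex_m.
have m0 : (0 < m)%N by case: (posnP m) Nm => // ->; rewrite expr0; lra.
(* If [n < m], minimality of [m] gives [2 ^+ n < 25 * N], so an exact table costs at most
   [24 * 25 = 600] times [N / n]. *)
have [mn|nm] := leqP m n; last first.
  have [C [Cs CE]] := table_circuit f n0; exists C; split; last first.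
    rewrite /Pr (eq_bigl xpredT) => [|x]; last by rewrite CE eqxx.
    case: distH => _ ->; lra.
  have lt_n : 2 ^+ n < 25 * N.
    by rewrite ltNge; apply/negP => /min_m; rewrite leqNgt nm.
  have Nn : N / n%:R <= N / log2 N by apply: Nlog; lra.
  have : (circuit_size C)%:R <= 600 * (N / n%:R).
    rewrite mulrA ler_pdivlMr ?ltr0n // -natrM.
    by apply: le_trans (_ : 24 * 2 ^+ n <= _); [rewrite -natrX -natrM ler_nat | lra].
  have : 0 <= n%:R :> R by exact: ler0n.
  have : 0 < N / log2 N by exact: divr_gt0.
  lra.
have lt_m : 2 ^+ m < 50 * N.
  have : ~~ (25 * N <= 2 ^+ m.-1).
    by apply/negP => /min_m; rewrite leqNgt prednK // leqnn.
  by rewrite -ltNge -[in 2 ^+ m](prednK m0) exprS; lra.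
have cm := card_tuple_le_quarters m; lazy zeta in cm.
have D0 : 0 < 2 ^+ (n - m) :> R by rewrite exprn_gt0.
have fib (b : m.-tuple bool) :
    #|[pred x : n.-tuple bool | [tuple tnth x (widen_ord mn i) | i < m] == b]|%:R
    <= 2 ^+ (n - m) :> R.
  by rewrite -natrX ler_nat; exact: card_prefix_fiber.
(* Multiplied by [2 ^+ m], this is the defining inequality [25 * N <= 2 ^+ m]. *)
have gD : 25 * gamma ^+ 2 * 2 ^+ (n - m) <= 1.
  have pm0 : 0 < 2 ^+ m :> R by rewrite exprn_gt0.
  have split_n : 2 ^+ (n - m) * 2 ^+ m = 2 ^+ n :> R by rewrite -exprD subnK.
  rewrite -(ler_pM2r pm0) mul1r -[X in X <= _]mulrA split_n.
  by rewrite -mulrA.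
have [[r L] [tau good]] := exists_good_predictor f (@bits_inj n) cm D0 fib distH gamma0 gD.
have [C [Cs CE]] := predictor_circuit mn r L tau m0 (erefl _).
exists C; split; last first.
  by apply: le_trans good _; rewrite /Pr /=; under [leRHS]eq_bigl do rewrite CE.
have Nm' : N / m%:R <= N / log2 N by apply: Nlog; lra.
have : (circuit_size C)%:R <= 12 * n%:R + 500 * 400 * (N / m%:R).
  rewrite mulrA -(ler_pM2r (_ : 0 < m%:R)) ?ltr0n // mulrDl divfK; last first.
    by rewrite pnatr_eq0 -lt0n.
  have : (circuit_size C * m)%:R <= (12 * n * m + 4000 * 2 ^ m)%:R :> R by rewrite ler_nat.
  by rewrite natrD !natrM natrX; lra.
have : 0 <= n%:R :> R by exact: ler0n.
lra.
Qed.
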